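(* Let $G$ and $H$ be graphs, neither of which is isomorphic to a complete graph, such that the Cartesian product $G\Box H$ is connected. Then $th(G\Box H)=2$.
   Context: All graphs are finite, undirected, without loops or multiple edges. The Cartesian product $G\Box H$ has vertex set $V(G)\times V(H)$, and $(g_1,h_1)$, $(g_2,h_2)$ are adjacent when ($g_1g_2\in E(G)$ and $h_1=h_2$) or ($g_1=g_2$ and $h_1h_2\in E(H)$). For distinct non-adjacent vertices $u,v$ of a graph $F$, a tolled walk between $u$ and $v$ is a sequence of vertices $u,w_1,\ldots,w_k,v$ with $k\ge 1$ such that $w_iw_{i+1}\in E(F)$ for all $1\le i<k$, $uw_i\in E(F)$ if and only if $i=1$, and $vw_i\in E(F)$ if and only if $i=k$. If $uv\in E(F)$, the only tolled walk between $u$ and $v$ is $u,v$; the only tolled walk from $v$ to $v$ is $v$ itself. The toll interval $T_F(u,v)$ is the set of all vertices lying on some tolled walk between $u$ and $v$. A set $S\subseteq V(F)$ is t-convex if $T_F(u,v)\subseteq S$ for all $u,v\in S$. The t-convex hull $[S]_t$ of $S\subseteq V(F)$ is the intersection of all t-convex sets containing $S$; $S$ is a t-hull set of $F$ if $[S]_t=V(F)$. The t-hull number $th(F)$ is the minimum size of a t-hull set of $F$. *)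

(* Defs.v *)
From mathcomp Require Import all_boot.
From mathcomp Require Import boolp.

Set Implicit Arguments.
Unset Strict Implicit.
Unset Printing Implicit Defensive.

Record sgraph := SGraph {
  vertex :> finType;
  edge : rel vertex;
  edge_sym : symmetric edge;
  edge_irrefl : irreflexive edge }.

Definition isomorphic (G H : sgraph) : Prop :=
  exists2 f : G -> H, bijective f &
    forall x y : G, edge (f x) (f y) = edge x y.

Fact complete_sym n : symmetric (fun i j : 'I_n => i != j).
Proof. by move=> i j; rewrite eq_sym. Qed.

Fact complete_irrefl n : irreflexive (fun i j : 'I_n => i != j).
Proof. by move=> i; rewrite eqxx. Qed.

(* The case n = 0 is included: the empty graph counts as complete. *)
Definition complete_graph (n : nat) : sgraph :=
  SGraph (@complete_sym n) (@complete_irrefl n).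

Definition connected (F : sgraph) : Prop :=
  forall x y : F, connect (@edge F) x y.

Section CartesianProduct.

Variables G H : sgraph.

Definition cart_edge (x y : G * H) : bool :=
  (edge x.1 y.1 && (x.2 == y.2)) || ((x.1 == y.1) && edge x.2 y.2).

Fact cart_edge_sym : symmetric cart_edge.
Proof.
by move=> x y; rewrite /cart_edge edge_sym (eq_sym x.2) (eq_sym x.1) (edge_sym x.2).
Qed.

Fact cart_edge_irrefl : irreflexive cart_edge.
Proof. by move=> x; rewrite /cart_edge !edge_irrefl andbF. Qed.

Definition cart_prod : sgraph := SGraph cart_edge_sym cart_edge_irrefl.

End CartesianProduct.

Section Toll.

Variable F : sgraph.
Implicit Types (u v x : F) (S C : {set F}) (p w : seq F).

(* [w] is the list w_1, ..., w_k of inner vertices of a tolled walk between *)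
(* distinct non-adjacent u and v; positions are numbered from 0 here.       *)
Definition tolled_inner u v w : Prop :=
  [/\ 0 < size w,
      forall i, i.+1 < size w -> edge (nth u w i) (nth u w i.+1),
      forall i, i < size w -> edge u (nth u w i) = (i == 0) &
      forall i, i < size w -> edge v (nth u w i) = (i == (size w).-1)].

Definition tolled_walk u v p : Prop :=
  if u == v then p = [:: v]
  else if edge u v then p = [:: u; v]
  else exists2 w, p = u :: rcons w v & tolled_inner u v w.

Definition toll_interval u v : {set F} :=
  [set x | `[< exists2 p, tolled_walk u v p & x \in p >]].

Definition t_convex S : bool :=
  [forall u in S, forall v in S, toll_interval u v \subset S].

Definition t_hull S : {set F} :=
  \bigcap_(C : {set F} | t_convex C && (S \subset C)) C.

Definition t_hull_set S : bool := t_hull S == [set: F].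

(* Ensures that the minimum in [t_hull_number] is over a nonempty family. *)
Fact t_hull_setT : t_hull_set [set: F].
Proof.
rewrite /t_hull_set eqEsubset subsetT; apply/bigcapsP => C.
by case/andP.
Qed.

Definition t_hull_number : nat :=
  #|[arg min_(S < [set: F] | t_hull_set S) #|S|]|.

End Toll.

(* Main.v *)
Require Import Defs.
From mathcomp Require Import all_boot.
From mathcomp Require Import boolp.

(** Call a vertex of a connected graph _dispensable_ when deleting it leaves the
    graph connected.  A connected graph with at least two vertices has two
    distinct dispensable vertices ([exists_dispensable], used twice), so one can
    pick dispensable g <> g' in G and h <> h' in H.  The two vertices u = (g, h)
    and v = (g', h') already span everything: every other vertex of the product
    lies in the toll interval between u and v.

    The point is that the closed neighbourhood of u is contained in the cross
    {g} x H + G x {h}, whose complement (G - g) x (H - h) is connected.  Every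
    vertex x <> u is in that complement or adjacent to it, so x can walk to v
    without meeting a neighbour of u after its start ([dispensable_escapable]).
    Stopping such a walk at the first neighbour of v, doing the same from x
    towards u, and glueing the two walks at x yields a tolled walk through x
    ([mem_toll_interval]).  Conversely one vertex is not enough, because sets
    with at most one element are t-convex. *)

Set Implicit Arguments.
Unset Strict Implicit.
Unset Printing Implicit Defensive.

(** * Walks in relations *)

Lemma connect_homo (T T' : finType) (e : rel T) (e' : rel T') (f : T -> T') :
    (forall x y, e x y -> connect e' (f x) (f y)) ->
  forall x y, connect e x y -> connect e' (f x) (f y).
Proof.
move=> ef x _ /connectP[p ep ->]; elim: p x ep => [|z p IHp] x //=.
by case/andP=> /ef exz /IHp; apply: connect_trans.
Qed.

Lemma path_first_hit (T : Type) (e : rel T) (a : pred T) x p :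
    path e x p -> a (last x p) ->
  exists q, [/\ path e x q, a (last x q) & all (predC a) (belast x q)].
Proof.
elim: p x => [|y p IHp] x /=; first by exists [::].
case/andP=> exy /IHp{}IHp /IHp[q [eq aq Nq]].
case ax: (a x); first by exists [::].
by exists (y :: q); rewrite /= exy eq aq ax.
Qed.

(** * Tolled walks through a given vertex *)

Section TollInterval.

Variable F : sgraph.
Implicit Types u v x y : F.

(** Only the vertices entered are tested, not the starting one: this lets a walk
    start at a neighbour of [u], as it must when that neighbour is the second
    vertex of a tolled walk. *)
Definition edge_off u : rel F := [rel x y | edge x y && ~~ edge u y].

(** No vertex other than [u] is trapped by the neighbourhood of [u]. *)
Definition escapable u : Prop :=
  forall x y, x != u -> y != u -> ~~ edge u y -> connect (edge_off u) x y.

Lemma path_edge_off u x p :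
  path (edge_off u) x p -> path (@edge F) x p /\ all (predC (edge u)) p.
Proof.
by elim: p x => //= y p IHp x /andP[/andP[-> ->] /IHp].
Qed.

Lemma escape_walk u v x :
    escapable u -> v != u -> ~~ edge u v -> x != u -> x != v ->
  exists q, [/\ path (@edge F) x q, all (predC (edge u)) q, edge v (last x q)
              & all (predC (edge v)) (belast x q)].
Proof.
move=> esc vu uv xu xv.
have /connectP[p] := esc x v xu vu uv.
case/lastP: p => [|p y] /= ep; first by move=> vx; rewrite vx eqxx in xv.
rewrite last_rcons => vy; move: ep; rewrite -vy rcons_path.
case/andP=> ep /andP[pv _]; rewrite edge_sym in pv.
have [q [/path_edge_off[eq uq] vq Nvq]] := path_first_hit ep pv.
by exists q.
Qed.

Lemma tolled_inner_glue u v x p q :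
    path (@edge F) x p -> all (predC (edge v)) p ->
    edge u (last x p) -> all (predC (edge u)) (belast x p) ->
    path (@edge F) x q -> all (predC (edge u)) q ->
    edge v (last x q) -> all (predC (edge v)) (belast x q) ->
  tolled_inner u v (rev p ++ x :: q).
Proof.
move=> ep vp up Nup eq uq vq Nvq.
have defw : rev p ++ x :: q = last x p :: rev (belast x p) ++ q.
  by rewrite -cat_rcons -rev_cons lastI rev_rcons.
have defw' : rev p ++ x :: q = rcons (rev p ++ belast x q) (last x q).
  by rewrite lastI rcons_cat.
split.
- by rewrite defw.
- move=> i; rewrite defw /= ltnS => lti.
  have ew : path (@edge F) (last x p) (rev (belast x p) ++ q).
    rewrite cat_path rev_path (eq_path (e' := @edge F)); last first.
      by move=> y z /=; rewrite edge_sym.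
    rewrite ep /=; suff -> : last (last x p) (rev (belast x p)) = x by [].
    by case: {+}p => //= y s; rewrite rev_cons last_rcons.
  by move/(pathP u): ew; apply.
- case=> [|i]; rewrite defw /= ?ltnS // => lti; apply/negbTE.
  have: all (predC (edge u)) (rev (belast x p) ++ q) by rewrite all_cat all_rev Nup.
  by move/all_nthP; apply.
- move=> i; rewrite defw' size_rcons ltnS nth_rcons /= leq_eqVlt.
  case: eqVneq => [-> _|_ /= lti]; first by rewrite ltnn.
  rewrite lti; apply/negbTE.
  have: all (predC (edge v)) (rev p ++ belast x q) by rewrite all_cat all_rev vp.
  by move/all_nthP; apply.
Qed.

(** The walk is made of an escape from [x] to [u] which stops at the first
    neighbour of [u], reversed, and one from [x] to [v].  The first one avoids
    the neighbours of [v] and the second those of [u], except perhaps at [x]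
    itself, which is then at the required end. *)
Lemma mem_toll_interval u v x :
    escapable u -> escapable v -> u != v -> ~~ edge u v ->
  x != u -> x != v -> x \in toll_interval u v.
Proof.
move=> escu escv uv Euv xu xv; have vu : v != u by rewrite eq_sym.
have Evu : ~~ edge v u by rewrite edge_sym.
have [q [eq uq vq Nvq]] := escape_walk escu vu Euv xu xv.
have [p [ep vp up Nup]] := escape_walk escv uv Evu xv xu.
rewrite inE; apply/asboolP; exists (u :: rcons (rev p ++ x :: q) v).
  rewrite /tolled_walk (negbTE uv) (negbTE Euv).
  by exists (rev p ++ x :: q) => //; exact: tolled_inner_glue.
by rewrite inE mem_rcons inE mem_cat inE eqxx !orbT.
Qed.

Lemma t_hull_set_escapable u v :
    escapable u -> escapable v -> u != v -> ~~ edge u v ->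
  t_hull_set [set u; v].
Proof.
move=> escu escv uv Euv; rewrite /t_hull_set eqEsubset subsetT.
apply/bigcapsP => C /andP[/forall_inP cvxC]; rewrite subUset !sub1set.
case/andP=> Cu Cv; apply/subsetP => x _.
have [-> // | xu] := eqVneq x u; have [-> // | xv] := eqVneq x v.
have /forall_inP/(_ v Cv)/subsetP := cvxC u Cu; apply.
exact: mem_toll_interval.
Qed.

Lemma t_convex_card_le1 (S : {set F}) : #|S| <= 1 -> t_convex S.
Proof.
move/card_le1_eqP => S1; apply/forall_inP => u Su; apply/forall_inP => v Sv.
apply/subsetP => x; rewrite inE => /asboolP[p].
by rewrite /tolled_walk (S1 u v Su Sv) eqxx => ->; rewrite inE => /eqP->.
Qed.

Lemma t_hull_set_gt1 (S : {set F}) : 1 < #|F| -> t_hull_set S -> 1 < #|S|.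
Proof.
move=> F1 /eqP hS; rewrite ltnNge; apply: contraL F1 => S1.
rewrite -leqNgt -cardsT (leq_trans _ S1) // subset_leq_card // -hS.
by apply: bigcap_inf; rewrite t_convex_card_le1 /=.
Qed.

Lemma t_hull_number_eq2 (S : {set F}) :
  1 < #|F| -> t_hull_set S -> #|S| <= 2 -> t_hull_number F = 2.
Proof.
move=> F1 hS S2; rewrite /t_hull_number.
case: arg_minnP => [|A hA minA]; first exact: t_hull_setT.
by apply/eqP; rewrite eqn_leq (leq_trans (minA S hS)) // t_hull_set_gt1.
Qed.

End TollInterval.

(** * Dispensable vertices *)

Section Dispensable.

Variable F : sgraph.
Implicit Types g r x y : F.

Definition edge_in (A : {set F}) : rel F :=
  [rel x y | [&& edge x y, x \in A & y \in A]].

Definition dispensable g : Prop :=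
  forall x y, x != g -> y != g -> connect (edge_in [set~ g]) x y.

Lemma connect_edge_inC A x y : connect (edge_in A) x y = connect (edge_in A) y x.
Proof.
apply: sym_connect_sym => a b.
by rewrite /edge_in /= edge_sym (andbC (_ \in _)).
Qed.

Lemma edge_in_sub (A B : {set F}) : A \subset B ->
  forall x y, connect (edge_in A) x y -> connect (edge_in B) x y.
Proof.
move=> /subsetP sAB; apply: connect_sub => x y /and3P[exy Ax Ay].
by apply: connect1; rewrite /edge_in /= exy !sAB.
Qed.

Lemma boundary_edge (A : {set F}) r y : connected F -> r \in A -> y \notin A ->
  exists a b, [/\ a \in A, b \notin A & edge a b].
Proof.
move=> cF Ar Ay; apply: contrapT => noAB.
suff clA : closed (@edge F) (mem A).
  by move: Ay; rewrite -(closed_connect clA (cF r y)) Ar.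
apply: intro_closed; first by apply: sym_connect_sym; apply: edge_sym.
move=> a b eab Aa; apply: contrapT => /negP Ab.
by apply: noAB; exists a, b.
Qed.

(** A maximal connected proper subset containing [r] misses exactly one vertex:
    otherwise an edge leaving it would extend it by one vertex and keep it
    proper. *)
Lemma exists_dispensable r :
  connected F -> 1 < #|F| -> exists2 g, g != r & dispensable g.
Proof.
move=> cF F1.
pose P (A : {set F}) :=
  [&& r \in A, A != [set: F] & [forall x in A, connect (edge_in A) r x]].
have P0 : P [set r].
  apply/and3P; split; first by rewrite inE.
    by apply: contraTneq F1 => r1; rewrite -cardsT -r1 cards1.
  by apply/forall_inP => x; rewrite inE => /eqP->.
have [A /and3P[Ar AT /forall_inP cA] maxA] := arg_maxnP (fun A : {set F} => #|A|) P0.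
have /subsetPn[y _ Ay] : ~~ ([set: F] \subset A) by rewrite subTset.
have [a [b [Aa Ab eab]]] := boundary_edge cF Ar Ay.
have cbA : [forall x in b |: A, connect (edge_in (b |: A)) r x].
  have sub := edge_in_sub (subsetUr [set b] A).
  apply/forall_inP => x; rewrite in_setU1 => /predU1P[->|/cA/sub//].
  apply: connect_trans (sub _ _ (cA a Aa)) (connect1 _).
  by rewrite /edge_in /= eab !in_setU1 Aa eqxx orbT.
have defA : A = [set~ b].
  have bAT : b |: A = [set: F].
    apply/eqP; apply: contraT => bAT.
    have /maxA : P (b |: A) by rewrite /P in_setU1 Ar orbT bAT cbA.
    by rewrite /= cardsU1 Ab add1n ltnn.
  apply/setP => x; rewrite !inE; case: eqVneq => [->|xb]; first exact: negbTE.
  by have := in_setT x; rewrite -bAT in_setU1 (negbTE xb).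
exists b; first by apply: contraNneq Ab => ->.
move=> x z xb zb; rewrite -defA (connect_trans (y := r)) //.
  by rewrite connect_edge_inC cA // defA !inE.
by rewrite cA // defA !inE.
Qed.

Lemma exists_neighbour r : connected F -> 1 < #|F| -> exists x, edge r x.
Proof.
move=> cF F1; have [y yr _] := exists_dispensable r cF F1.
have [||a [b [/set1P-> _ rb]]] := @boundary_edge [set r] r y cF.
- by rewrite inE.
- by rewrite inE.
by exists b.
Qed.

Lemma noncomplete_gt1 :
  (forall n, ~ isomorphic F (complete_graph n)) -> 1 < #|F|.
Proof.
move=> ncF; rewrite ltnNge; apply/negP => F1; apply: (ncF #|F|).
exists enum_rank; first exact: enum_rank_bij.
move=> x y; have -> : x = y by exact: (fintype_le1P F1 y x).
by rewrite !edge_irrefl.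
Qed.

End Dispensable.

(** * Cartesian products *)

Section Product.

Variables G H : sgraph.

Lemma connected_cart_fst : H -> connected (cart_prod G H) -> connected G.
Proof.
move=> h cGH x y.
apply: (connect_homo (f := fst) _ (cGH (x, h) (y, h))) => -[a b] [c d] /=.
rewrite /cart_edge /=.
by case/orP => /andP[] => [/connect1 // | /eqP-> _]; apply: connect0.
Qed.

Lemma connected_cart_snd : G -> connected (cart_prod G H) -> connected H.
Proof.
move=> g cGH x y.
apply: (connect_homo (f := snd) _ (cGH (g, x) (g, y))) => -[a b] [c d] /=.
rewrite /cart_edge /=.
by case/orP => /andP[] => [_ /eqP-> | _ /connect1 //]; apply: connect0.
Qed.

(** The vertices [(a, b)] with [a != g] and [b != h] are not adjacent to [(g, h)]
    and induce a connected subgraph; every other vertex except [(g, h)] has a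
    neighbour among them, by moving off the line it shares with [(g, h)]. *)
Lemma dispensable_escapable g h :
    connected G -> connected H -> 1 < #|G| -> 1 < #|H| ->
  dispensable g -> dispensable h -> @escapable (cart_prod G H) (g, h).
Proof.
move=> cG cH G1 H1 dg dh.
pose M : pred (G * H) := fun z => (z.1 != g) && (z.2 != h).
have offM z : M z -> ~~ cart_edge (g, h) z.
  by case/andP=> zg zh; rewrite /cart_edge /= !(eq_sym _ z.1) !(eq_sym _ z.2)
    (negbTE zg) (negbTE zh) andbF.
have toM z : z != (g, h) -> exists2 m, M m & m = z \/ cart_edge z m.
  case: z => a b; rewrite xpair_eqE /M /cart_edge.
  have [-> /= bh | ag _] := eqVneq a g.
    have [c gc] := exists_neighbour g cG G1.
    exists (c, b); last by right; rewrite gc eqxx.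
    by rewrite /= bh andbT; apply: contraTneq gc => ->; rewrite edge_irrefl.
  have [-> | bh] := eqVneq b h; last by exists (a, b); [rewrite /= ag | left].
  have [c hc] := exists_neighbour h cH H1.
  exists (a, c); last by right; rewrite /= eqxx hc orbT.
  by rewrite /= ag; apply: contraTneq hc => ->; rewrite edge_irrefl.
have cM m n : M m -> M n -> connect (@edge_off (cart_prod G H) (g, h)) m n.
  case: m n => [a b] [c d] Mm Mn.
  have /andP[/= ag bh] := Mm; have /andP[/= cg dh'] := Mn.
  apply: (@connect_trans _ _ (c, b)).
    apply: (connect_homo (f := fun z => (z, b) : G * H) _ (dg a c ag cg)).
    move=> x y /and3P[xy _ yg]; apply: connect1; rewrite /edge_off /= offM ?andbT.
      by rewrite /cart_edge /= xy eqxx.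
    by rewrite /M /= bh andbT; rewrite !inE in yg.
  apply: (connect_homo (f := fun z => (c, z) : G * H) _ (dh b d bh dh')).
  move=> x y /and3P[xy _ yh]; apply: connect1; rewrite /edge_off /= offM ?andbT.
    by rewrite /cart_edge /= xy eqxx orbT.
  by rewrite /M /= cg; rewrite !inE in yh.
move=> x y xu yu uy.
have [m Mm xm] := toM x xu; have [n Mn yn] := toM y yu.
apply: (@connect_trans _ _ m).
  by case: xm => [-> // | xm]; apply: connect1; rewrite /edge_off /= xm offM.
apply: (connect_trans (cM m n Mm Mn)).
by case: yn => [-> // | yn]; apply: connect1; rewrite /edge_off /= cart_edge_sym yn.
Qed.

End Product.

Theorem corollary3p3 (G H : sgraph)
  (hG : forall n : nat, ~ isomorphic G (complete_graph n))
  (hH : forall n : nat, ~ isomorphic H (complete_graph n))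
  (hGH : connected (cart_prod G H)) :
  t_hull_number (cart_prod G H) = 2.
Proof.
have G1 := noncomplete_gt1 hG; have H1 := noncomplete_gt1 hH.
have /card_gt0P[g0 _] := ltnW G1; have /card_gt0P[h0 _] := ltnW H1.
have cG := connected_cart_fst h0 hGH; have cH := connected_cart_snd g0 hGH.
have [g _ dg] := exists_dispensable g0 cG G1.
have [g' gg' dg'] := exists_dispensable g cG G1.
have [h _ dh] := exists_dispensable h0 cH H1.
have [h' hh' dh'] := exists_dispensable h cH H1.
have uv : (g, h) != (g', h') by rewrite xpair_eqE eq_sym (negbTE gg').
apply: (@t_hull_number_eq2 (cart_prod G H) [set (g, h); (g', h')]).
- by rewrite card_prod (leq_trans G1) // leq_pmulr // ltnW.
- apply: t_hull_set_escapable => //; try exact: dispensable_escapable.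
  by rewrite /= /cart_edge /= !(eq_sym _ g') !(eq_sym _ h') (negbTE gg')
    (negbTE hh') andbF.
- by rewrite cards2 ltnS leq_b1.
Qed.
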